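(* For any connected digraph $D$ of order $n\ge3$, $L^t_2(D)+L^t_2(D^{-1})\le\frac{16n}{9}$. This bound is sharp (attained by some connected digraphs).
   Context: Digraphs are finite, without loops or multiple arcs (opposite arcs allowed); connected means the underlying graph is connected. $D^{-1}$ is the converse of $D$, obtained by reversing every arc. A vertex $u$ is adjacent with $v$ if $(u,v)$ or $(v,u)$ is an arc. A total $2$-limited packing is a set $B\subseteq V(D)$ such that every vertex in $B$ is adjacent with at most one vertex of $B$ and every vertex in $V(D)\setminus B$ has at most two out-neighbours in $B$; $L^t_2(D)$ is its maximum size. *)

(* Defs.v *)
From HB Require Import structures.
From mathcomp Require Import all_boot all_order all_algebra.
Set Implicit Arguments.
Unset Strict Implicit.
Unset Printing Implicit Defensive.

(* Encoding arcs as a boolean relation excludes multiple arcs and allows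
   opposite ones. *)
Record digraph := Digraph {
  vertex : finType;
  arc : rel vertex;
  arc_irrefl : irreflexive arc
}.

Definition digraph_order (D : digraph) : nat := #|vertex D|.

Definition converse_arc (D : digraph) : rel (vertex D) :=
  fun u v => arc v u.

Lemma converse_arc_irrefl (D : digraph) : irreflexive (@converse_arc D).
Proof. by move=> u; rewrite /converse_arc arc_irrefl. Qed.

Definition converse (D : digraph) : digraph :=
  Digraph (@converse_arc_irrefl D).

Definition adjacent (D : digraph) : rel (vertex D) :=
  fun u v => arc u v || arc v u.

Definition connected (D : digraph) : Prop :=
  forall u v : vertex D, connect (@adjacent D) u v.

Definition total_2limited_packing (D : digraph) (B : {set vertex D}) : bool :=
  [forall u in B, #|[set v in B | adjacent u v]| <= 1]
  && [forall u in ~: B, #|[set v in B | arc u v]| <= 2].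

(* The empty set is a packing, so this maximum is attained. *)
Definition Lt2 (D : digraph) : nat :=
  \max_(B : {set vertex D} | total_2limited_packing B) #|B|.

(* Main.v *)
Require Import Defs.
From HB Require Import structures.
From mathcomp Require Import all_boot all_order all_algebra.
From mathcomp Require Import zify.
Import Order.TTheory GRing.Theory Num.Theory.
Local Open Scope ring_scope.

(** Let [B] and [B'] be optimal packings of [D] and of its converse, and let
    [I] be their intersection.  The components of [I] have at most two vertices,
    and by connectedness each of them has a vertex adjacent with the complement
    of [I].  A vertex outside both packings is adjacent with at most four
    vertices of [I] (two out-neighbours, two in-neighbours), and a vertex lying
    in exactly one packing is adjacent with at most one.  Hence
    [#|I| <= 2 * (4 * x + y)], where [x] and [y] count these two kinds of
    vertices, and this gives [9 * (#|B| + #|B'|) <= 16 * n].  Equality holds for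
    four disjoint arcs joined to a central vertex that dominates two of them and
    is dominated by the other two. *)

Lemma leq_card_bigcup (T : finType) (A : {set T}) (F : T -> {set T}) (k : nat) :
  (forall w, w \in A -> (#|F w| <= k)%N) ->
  (#|\bigcup_(w in A) F w| <= k * #|A|)%N.
Proof.
move=> Fk; rewrite mulnC -sum_nat_const.
apply: (big_ind2 (fun (S : {set T}) m => #|S| <= m)%N) => //.
- by rewrite cards0.
- move=> S1 m1 S2 m2 le1 le2.
  by rewrite (leq_trans (leq_card_setU _ _)) // leq_add.
Qed.

(** * Packings in a connected digraph and their boundaries *)

Section Packings.

Variable D : digraph.
Implicit Types (B S : {set vertex D}) (u v w : vertex D).

Lemma adjacentC u v : adjacent u v = adjacent v u.
Proof. by rewrite /adjacent orbC. Qed.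

(** Otherwise [S] would be closed under adjacency and, by connectedness, contain every vertex. *)
Lemma connected_adjacent_outside S : connected D -> S != set0 -> S != setT ->
  exists u v, [/\ u \in S, v \notin S & adjacent u v].
Proof.
move=> conD /set0Pn[s sS] SnT.
case: (boolP [exists u, exists v, [&& u \in S, v \notin S & adjacent u v]]).
  by case/existsP=> u /existsP[v /and3P[uS vS uv]]; exists u, v.
rewrite negb_exists => /forallP clS; case/eqP: SnT; apply/setP=> t.
rewrite inE -(@closed_connect _ (@adjacent D) (mem S) _ s t) //.
apply: intro_closed; first exact/sym_connect_sym/adjacentC.
move=> u v uv uS; move: (clS u); rewrite negb_exists => /forallP/(_ v).
by rewrite uS uv andbT negbK.
Qed.

Lemma packing_adjacent_uniq B u v w : total_2limited_packing B ->
  u \in B -> v \in B -> w \in B -> adjacent u v -> adjacent u w -> v = w.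
Proof.
case/andP=> /forall_inP degB _ uB vB wB uv uw.
by move/card_le1_eqP: (degB u uB); apply; rewrite inE ?vB ?wB.
Qed.

Lemma card_adjacent_packing B S u : total_2limited_packing B -> S \subset B ->
  u \in B -> (#|[set v in S | adjacent u v]| <= 1)%N.
Proof.
case/andP=> /forall_inP degB _ /subsetP SB uB; apply: leq_trans (degB u uB).
by apply/subset_leq_card/subsetP=> v; rewrite !inE => /andP[/SB-> ->].
Qed.

Lemma card_out_packing B S u : total_2limited_packing B -> S \subset B ->
  u \notin B -> (#|[set v in S | Defs.arc u v]| <= 2)%N.
Proof.
case/andP=> _ /forall_inP outB /subsetP SB uB; apply: leq_trans (outB u _).
  by apply/subset_leq_card/subsetP=> v; rewrite !inE => /andP[/SB-> ->].
by rewrite inE.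
Qed.

Definition boundary S := [set v in S | [exists w in ~: S, adjacent w v]].

(** Each vertex of [S] off the boundary is adjacent with a boundary vertex, and no two share one,
    since a vertex of [B] has at most one neighbour in [B]. *)
Lemma card_packing_boundary B S : connected D -> (3 <= digraph_order D)%N ->
  total_2limited_packing B -> S \subset B -> (#|S| <= 2 * #|boundary S|)%N.
Proof.
move=> conD n_ge3 packB /subsetP SB; set T := boundary S.
have TS : T \subset S by apply/subsetP=> v; rewrite inE => /andP[].
have inner v w : v \in S -> v \notin T -> adjacent v w -> w \in S.
  rewrite inE => vS; rewrite vS /= => /exists_inPn vT vw; apply/negPn/negP=> wS.
  by move: (vT w); rewrite inE wS adjacentC vw => /(_ isT).
have proper (A : {set vertex D}) : (#|A| <= 2)%N -> A != setT.
  apply: contraTneq => ->; rewrite cardsT -ltnNge; exact: n_ge3.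
have partner v : v \in S :\: T -> exists2 w, w \in T & adjacent v w.
  rewrite inE => /andP[vT vS].
  have [||u [w [/set1P-> _ vw]]] := @connected_adjacent_outside [set v] conD.
  - by apply/set0Pn; exists v; rewrite inE.
  - by apply: proper; rewrite cards1.
  (* If [w] were off the boundary too, an adjacency leaving the pair [v], [w] (one exists as the
     order is at least 3) would end in [S], giving [v] or [w] a second neighbour in [B]. *)
  exists w => //; apply/negPn/negP=> wT; have wS := inner _ _ vS vT vw.
  have [||a [b [+ + ab]]] := @connected_adjacent_outside [set v; w] conD.
  - by apply/set0Pn; exists v; rewrite !inE eqxx.
  - by apply: proper; rewrite cards2; case: (_ == _).
  rewrite !inE negb_or => /orP[]/eqP ea /andP[bv bw]; subst a.
  + have bS := inner _ _ vS vT ab.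
    by case/eqP: bw; apply: (packing_adjacent_uniq B v) ab vw => //; apply: SB.
  + have bS := inner _ _ wS wT ab.
    case/eqP: bv; apply: (packing_adjacent_uniq B w) ab _ => //; try exact: SB.
    by rewrite adjacentC.
pose p v := odflt v [pick w in T | adjacent v w].
have pP v : v \in S :\: T -> p v \in T /\ adjacent v (p v).
  move=> vST; rewrite /p; case: pickP => [w /andP[] //|no].
  by have [w wT vw] := partner v vST; move: (no w); rewrite /= wT vw.
have le_ST : (#|S :\: T| <= #|T|)%N.
  rewrite -(@card_in_imset _ _ p).
    by apply/subset_leq_card/subsetP=> _ /imsetP[v /pP[pT _] ->].
  move=> v w vST wST pvw; have [pT pv] := pP v vST; have [_ pw] := pP w wST.
  apply: (packing_adjacent_uniq B (p v)) => //.
  - exact/SB/(subsetP TS).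
  - by move: vST; rewrite inE => /andP[_ /SB].
  - by move: wST; rewrite inE => /andP[_ /SB].
  - by rewrite adjacentC.
  - by rewrite pvw adjacentC.
have := cardsID T S; rewrite (setIidPr TS); lia.
Qed.

Lemma packing_Lt2 : exists2 B : {set vertex D}, total_2limited_packing B & Lt2 D = #|B|.
Proof.
have pack0 : total_2limited_packing (set0 : {set vertex D}).
  apply/andP; split; apply/forall_inP=> u _; rewrite (leq_trans (n := 0)) //.
    by rewrite leqn0 cards_eq0; apply/eqP/setP=> v; rewrite !inE.
  by rewrite leqn0 cards_eq0; apply/eqP/setP=> v; rewrite !inE.
have [|B packB eB] := @eq_bigmax_cond _ (@total_2limited_packing D) (fun B => #|B|).
  by apply/card_gt0P; exists set0.
by exists B.
Qed.

End Packings.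

(** * The upper bound *)

Lemma packing_pair_bound (D : digraph)
    (B : {set vertex D}) (B' : {set vertex (converse D)}) :
  connected D -> (3 <= digraph_order D)%N ->
  total_2limited_packing B -> total_2limited_packing B' ->
  (9 * (#|B| + #|B'|) <= 16 * digraph_order D)%N.
Proof.
move=> conD n_ge3 packB packB'.
(* [D] and its converse have the same vertices, so [B'] can be retyped and intersected with [B]. *)
pose C : {set vertex D} := B'; pose S : {set vertex D} := B :&: C.
have SB : S \subset B by apply: subsetIl.
have SC : S \subset C by apply: subsetIr.
have adj_conv (u v : vertex D) : @adjacent (converse D) u v = adjacent u v.
  by rewrite /adjacent orbC.
pose F w := [set v in S | adjacent w v].
have TF : boundary D S \subset (\bigcup_(w in ~: (B :|: C)) F w)
    :|: ((\bigcup_(w in B :\: C) F w) :|: (\bigcup_(w in C :\: B) F w)).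
  apply/subsetP=> v; rewrite inE => /andP[vS /exists_inP[w wS wv]].
  have vF : v \in F w by rewrite inE vS.
  rewrite !in_setU; apply/or3P; case: (boolP (w \in B)) => wB.
  - apply: Or32; apply/bigcupP; exists w => //.
    by move: wS; rewrite !inE wB andbT.
  - case: (boolP (w \in C)) => wC.
    + by apply: Or33; apply/bigcupP; exists w; rewrite // inE wB.
    + by apply: Or31; apply/bigcupP; exists w; rewrite // !inE negb_or wB.
have FX : (#|\bigcup_(w in ~: (B :|: C)) F w| <= 4 * #|~: (B :|: C)|)%N.
  apply: leq_card_bigcup => w; rewrite !inE negb_or => /andP[wB wC].
  have le_out := card_out_packing _ _ _ _ packB SB wB.
  have le_in := @card_out_packing (converse D) B' S w packB' SC wC.
  have FE : F w \subset
      [set v in S | Defs.arc w v] :|: [set v in S | @Defs.arc (converse D) w v].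
    by apply/subsetP=> v; rewrite !inE => /andP[->].
  apply: leq_trans (subset_leq_card FE) _.
  by apply: leq_trans (leq_card_setU _ _) _; apply: (leq_add le_out le_in).
have FY : (#|\bigcup_(w in B :\: C) F w| <= 1 * #|B :\: C|)%N.
  apply: leq_card_bigcup => w; rewrite inE => /andP[_ wB].
  exact: card_adjacent_packing packB SB wB.
have FZ : (#|\bigcup_(w in C :\: B) F w| <= 1 * #|C :\: B|)%N.
  apply: leq_card_bigcup => w; rewrite inE => /andP[_ wC].
  have := @card_adjacent_packing (converse D) B' S w packB' SC wC.
  by under eq_finset => v do rewrite adj_conv.
have le_T := leq_trans (subset_leq_card TF) (leq_card_setU _ _).
have [le_YZ _] := leq_card_setU (\bigcup_(w in B :\: C) F w) (\bigcup_(w in C :\: B) F w).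
have le_S := card_packing_boundary _ _ _ conD n_ge3 packB SB.
have cB := cardsID C B; have cC := cardsID B C; rewrite (setIC C) in cC.
have cBC := cardsUI B C; have cV := cardsC (B :|: C).
rewrite -/S in cB cC cBC; rewrite /digraph_order -cV.
have -> : #|B'| = #|C| by [].
(* With [x], [y] as in the overview and [s] the size of [S], the goal
   [9 * (2 * s + y) <= 16 * (x + y + s)] amounts to [2 * s <= 16 * x + 7 * y], which follows from
   [s <= 8 * x + 2 * y]. *)
lia.
Qed.

Lemma Lt2_converse_bound (D : digraph) : connected D -> (3 <= digraph_order D)%N ->
  (9 * (Lt2 D + Lt2 (converse D)) <= 16 * digraph_order D)%N.
Proof.
move=> conD n_ge3; have [B packB ->] := packing_Lt2 D.
have [B' packB' ->] := packing_Lt2 (converse D).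
exact: packing_pair_bound.
Qed.

(** * Sharpness *)

Lemma Lt2_setC1 (D : digraph) (c : vertex D) (p : vertex D -> vertex D) :
  (forall u v, u != c -> v != c -> adjacent u v -> v = p u) ->
  (#|[set v | Defs.arc c v]| <= 2)%N -> ((digraph_order D).-1 <= Lt2 D)%N.
Proof.
move=> pP outc; rewrite /digraph_order -(cardsC1 c).
(* The packing is the complement of [c]: [p u] is the only possible neighbour of [u] in it, and only
   [c] lies outside. *)
apply: leq_bigmax_cond; apply/andP; split; apply/forall_inP=> u; rewrite !inE.
- move=> uc; rewrite -(cards1 (p u)); apply/subset_leq_card/subsetP=> v.
  by rewrite !inE => /andP[vc /pP->].
- rewrite negbK => /eqP->; apply: leq_trans outc.
  by apply/subset_leq_card/subsetP=> v; rewrite !inE => /andP[].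
Qed.

(* [None] is the centre; [Some (d, j, e)] lies in the [j]-th pair on the side
   [d] (true for the dominated side), and [e] marks the end joined to the
   centre. *)
Definition windmill_arc : rel (option (bool * bool * bool)) := fun u v =>
  match u, v with
  | None, Some (d, _, e) => d && e
  | Some (d, _, e), None => ~~ d && e
  | Some (d, j, e), Some (d', j', e') => [&& d == d', j == j', e & ~~ e']
  | None, None => false
  end.

Lemma windmill_arc_irrefl : irreflexive windmill_arc.
Proof. by case=> [[[[] []] []]|]. Qed.

Definition windmill : digraph := Digraph windmill_arc_irrefl.

Lemma windmill_connected : connected windmill.
Proof.
have sym := sym_connect_sym (adjacentC windmill).
suff toC (u : vertex windmill) : connect (@adjacent windmill) u None.
  by move=> u v; apply: connect_trans (toC u) _; rewrite sym.
have toC1 d j : connect (@adjacent windmill) (Some (d, j, true)) None.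
  by apply: connect1; case: d.
case: u => [[[d j] []]|] //; apply: connect_trans (toC1 d j).
by apply: connect1; rewrite /adjacent /= !eqxx.
Qed.

Lemma card_windmill : digraph_order windmill = 9%N.
Proof. by rewrite /digraph_order card_option !card_prod card_bool. Qed.

Definition windmill_mate (u : vertex windmill) : vertex windmill :=
  if u is Some (d, j, e) then Some (d, j, ~~ e) else None.

Lemma Lt2_windmill : (8 <= Lt2 windmill)%N.
Proof.
rewrite -[8%N]/(9.-1)%N -card_windmill; apply: (@Lt2_setC1 windmill None windmill_mate).
  by move=> [[[[] []] []]|] [[[[] []] []]|].
apply: (@leq_trans
  #|[set Some (true, true, true); Some (true, false, true)] : {set vertex windmill}|).
  by apply/subset_leq_card/subsetP; case=> [[[[] []] []]|]; rewrite !inE.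
by rewrite cards2.
Qed.

Lemma Lt2_converse_windmill : (8 <= Lt2 (converse windmill))%N.
Proof.
rewrite -[8%N]/(9.-1)%N -card_windmill.
apply: (@Lt2_setC1 (converse windmill) None windmill_mate).
  by move=> [[[[] []] []]|] [[[[] []] []]|].
(* Reversal swaps the sides: the centre now dominates the marked ends with [d] false. *)
apply: (@leq_trans
  #|[set Some (false, true, true); Some (false, false, true)] : {set vertex windmill}|).
  by apply/subset_leq_card/subsetP; case=> [[[[] []] []]|]; rewrite !inE.
by rewrite cards2.
Qed.

Theorem theorem6 :
  (forall D : digraph, connected D -> (3 <= digraph_order D)%N ->
     (Lt2 D + Lt2 (converse D))%:R <= 16 * (digraph_order D)%:R / 9 :> rat)
  /\
  (exists D : digraph, [/\ connected D, (3 <= digraph_order D)%N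
     & (Lt2 D + Lt2 (converse D))%:R = 16 * (digraph_order D)%:R / 9 :> rat]).
Proof.
split=> [D conD n_ge3|].
  by rewrite ler_pdivlMr // mulrC -!natrM ler_nat; apply: Lt2_converse_bound.
have n_ge3 : (3 <= digraph_order windmill)%N by rewrite card_windmill.
exists windmill; split=> //; first exact: windmill_connected.
(* At order 9 the upper bound is 16, matching the two lower bounds of 8. *)
have := Lt2_converse_bound _ windmill_connected n_ge3; rewrite card_windmill => le16.
have le8 := Lt2_windmill; have le8' := Lt2_converse_windmill.
have -> : (Lt2 windmill + Lt2 (converse windmill) = 16)%N by lia.
by rewrite mulfK.
Qed.
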